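(* Let $G$ be a finite digraph and $N\ge 2$. Every element of $\Omega_2^N=\Omega_2^N(P(G))$ can be represented as a $\mathbb{C}$-linear combination of double edges, triangles and squares of $G$.
   Context: A digraph $G=(V,E)$ is finite and simple: $V$ is finite, $E\subset V\times V$, no loops and no multiple edges (both $(i,j)$ and $(j,i)$ may be edges). Fix $N\ge 2$ and a primitive $N$-th root of unity $\xi\in\mathbb{C}$. An elementary $p$-path is a sequence of $p+1$ vertices, written $e_{i_0,\dots,i_p}$; it is regular if consecutive vertices are different and irregular otherwise. It is allowed (belongs to the path complex $P(G)$) if $(i_k,i_{k+1})\in E$ for all $k$. $\mathcal{A}_n$ is the $\mathbb{C}$-vector space with basis the allowed elementary $n$-paths, with $\mathcal{A}_n=0$ for $n<0$. The regular boundary operator is $\partial(e_{i_0,\dots,i_p})=\sum_{j=0}^p \xi^j e_{i_0,\dots,\widehat{i_j},\dots,i_p}$, where irregular paths on the right are replaced by $0$, and $\partial=0$ on $0$-paths. For $1\le q\le N-1$, $\Omega_n^{N,q}=\{v\in\mathcal{A}_n\mid \partial^q v\in\mathcal{A}_{n-q}\}$, and $\Omega_n^N=\bigcap_{1\le q\le N-1}\Omega_n^{N,q}$. As elements of $\mathcal{A}_2$: a double edge is $e_{i,j,i}$ with $(i,j),(j,i)\in E$; a triangle is $e_{i,j,k}$ with $i\ne k$ and $(i,j),(j,k),(i,k)\in E$; a square is $e_{i,j,k}-e_{i,l,k}$ with $j\neq l$, $i\ne k$, $(i,k)\notin E$ and $(i,j),(j,k),(i,l),(l,k)\in E$. *)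

(* Defs.v *)
From HB Require Import structures.
From mathcomp Require Import all_boot all_order all_algebra.
From mathcomp Require Export freeg.

Set Implicit Arguments.
Unset Strict Implicit.
Unset Printing Implicit Defensive.

Import GRing.Theory.
Local Open Scope ring_scope.

Record digraph := Digraph {
  vertex :> finType;
  edge : rel vertex;
  edge_irrefl : irreflexive edge
}.

Section PathHomology.

Variables (C : fieldType) (xi : C) (G : digraph).

(* An elementary p-path is a sequence of p + 1 vertices; chains of all degrees
   live in one free module, where [::] is an extra basis element representing
   no path. *)
Definition chain := {freeg (seq G) / C}.

Definition epath (s : seq G) : chain := << 1 *g s >>.

Definition regular (s : seq G) : bool := sorted (fun i j : G => i != j) s.

Definition allowed (s : seq G) : bool := (s != [::]) && sorted (@edge G) s.

Definition omit (j : nat) (s : seq G) : seq G := take j s ++ drop j.+1 s.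

(* The value on irregular s is irrelevant: allowed paths are regular (there are
   no loops) and boundaries are combinations of regular paths. *)
Definition bd_path (s : seq G) : chain :=
  if (size s <= 1)%N then 0
  else \sum_(j < size s | regular (omit j s)) xi ^+ j *: epath (omit j s).

Definition bd (v : chain) : chain := fglift bd_path v.

(* The space A_n: the support of v consists of allowed elementary n-paths.
   For n < 0 there are no such paths, so A_n = 0. *)
Definition in_A (n : int) (v : chain) : bool :=
  all (fun s => allowed s && ((size s)%:Z == n + 1)) (dom v).

Definition in_Omega_q (q : nat) (n : int) (v : chain) : Prop :=
  in_A n v /\ in_A (n - q%:Z) (iter q bd v).

Definition in_Omega (N : nat) (n : int) (v : chain) : Prop :=
  forall q : nat, (1 <= q <= N.-1)%N -> in_Omega_q q n v.

Definition is_double_edge (u : chain) : Prop :=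
  exists i j : G, [/\ edge i j, edge j i & u = epath [:: i; j; i]].

Definition is_triangle (u : chain) : Prop :=
  exists i j k : G,
    [/\ i != k, edge i j, edge j k, edge i k & u = epath [:: i; j; k]].

Definition is_square (u : chain) : Prop :=
  exists i j k l : G,
    [/\ j != l, i != k & ~~ edge i k] /\
    [/\ edge i j, edge j k, edge i l, edge l k
      & u = epath [:: i; j; k] - epath [:: i; l; k]].

End PathHomology.

(* Main.v *)
(** Only q = 1 matters.  If i <> k and (i,k) is not an edge, then e_{i,k}
    occurs in the boundary of v only through the deletion of the middle vertices
    of the paths e_{i,j,k}, so its coefficient is xi times the sum over j of the
    coefficients v_{i,j,k}.  This sum therefore vanishes and, fixing j0 with
    v_{i,j0,k} <> 0, the part of v supported on paths from i to k equals
    sum_j v_{i,j,k} (e_{i,j,k} - e_{i,j0,k}), a combination of squares.  The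
    remaining paths in v are double edges (i = k) or triangles. *)

From HB Require Import structures.
Require Import Defs.
From mathcomp Require Import all_boot all_order all_algebra.
From mathcomp Require Import reals.
From mathcomp Require Import complex.
Local Open Scope ring_scope.

Import GRing.Theory.

Set Implicit Arguments.
Unset Strict Implicit.
Unset Printing Implicit Defensive.

Section Span.

Variables (C : fieldType) (V : lmodType C) (P : V -> Prop).

(** The [u r] may repeat, so the sum of two combinations is obtained by concatenating their index
    ranges. *)
Definition spanned (v : V) : Prop :=
  exists (m : nat) (c : 'I_m -> C) (u : 'I_m -> V),
    (forall r, P (u r)) /\ v = \sum_(r < m) c r *: u r.

Lemma spanned0 : spanned 0.
Proof.
by exists 0, (fun=> 0), (fun=> 0); rewrite big_ord0; split=> // -[].
Qed.

Lemma spanned_scale (a : C) (u : V) : P u -> spanned (a *: u).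
Proof. by move=> Pu; exists 1, (fun=> a), (fun=> u); rewrite big_ord1. Qed.

Lemma spannedD (v w : V) : spanned v -> spanned w -> spanned (v + w).
Proof.
move=> [m [c [u [Pu ->]]]] [n [d [x [Px ->]]]].
exists (m + n)%N.
exists (fun r => match split r with inl i => c i | inr j => d j end).
exists (fun r => match split r with inl i => u i | inr j => x j end).
split=> [r|]; first by case: (split r).
rewrite big_split_ord; congr (_ + _); apply: eq_bigr => i _.
  by rewrite -[lshift n i]/(unsplit (inl i)) unsplitK.
by rewrite -[rshift m i]/(unsplit (inr i)) unsplitK.
Qed.

Lemma spanned_sum (I : finType) (F : I -> V) :
  (forall i, spanned (F i)) -> spanned (\sum_i F i).
Proof.
by move=> spF; apply: big_ind => //; [exact: spanned0 | exact: spannedD].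
Qed.

End Span.

Section Chains.

Variables (C : fieldType) (xi : C) (G : digraph).
Implicit Types (v : chain C G) (i j k : G) (s t : seq G).

Lemma coeff_epath s t : coeff t (epath C s) = (s == t)%:R.
Proof. by rewrite coeffU mul1r. Qed.

(** Lets [raddf_sum] push [bd] through finite sums; scalars on a single path are handled by
    [bd_scale_epath]. *)
HB.instance Definition _ := GRing.isZmodMorphism.Build (chain C G) (chain C G)
  (bd xi (G := G)) (lift_is_additive (bd_path xi (G := G))).

Lemma bd_scale_epath (a : C) s : bd xi (a *: epath C s) = a *: bd_path xi s.
Proof.
have -> : a *: epath C s = << a *g s >>.
  by apply/eqP/freeg_eqP => t; rewrite coeffZ !coeffU mul1r.
exact: liftU.
Qed.

Lemma in_A2P v s : in_A 2 v -> coeff s v != 0 ->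
  exists i j k, [/\ s = [:: i; j; k], edge i j & edge j k].
Proof.
move=> /allP Av; rewrite -mem_dom => /Av /andP[].
case: s => [|i [|j [|k [|]]]] //=.
by rewrite /allowed /= andbT => /andP[ij jk] _; exists i, j, k.
Qed.

(** Both sides have the same coefficient at every [s]. The middle vertex [j] is summed innermost, so
    that the paths from [i] to [k] form one block. *)
Lemma chain2_sumE v : in_A 2 v ->
  v = \sum_i \sum_k \sum_j coeff [:: i; j; k] v *: epath C [:: i; j; k].
Proof.
move=> Av; apply/eqP/freeg_eqP => s /=.
have [vs0|vs] := eqVneq (coeff s v) 0.
  rewrite vs0 raddf_sum big1 // => i _; rewrite raddf_sum big1 // => k _.
  rewrite raddf_sum big1 // => j _; rewrite /= coeffZ coeff_epath.
  by have [->|_] := eqVneq _ s; rewrite ?vs0 ?mul0r ?mulr0.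
have [a [b [c [-> _ _]]]] := in_A2P Av vs.
pose d i j k := (i == a) && ((j == b) && (k == c)).
have coefE i j k : coeff [:: a; b; c]
    (coeff [:: i; j; k] v *: epath C [:: i; j; k]) =
    coeff [:: i; j; k] v * (d i j k)%:R.
  by rewrite coeffZ coeff_epath !eqseq_cons andbT.
rewrite raddf_sum (bigD1 a) //= [X in _ + X]big1 ?addr0; last first.
  move=> i /negPf ia; rewrite raddf_sum big1 // => k _.
  by rewrite raddf_sum big1 // => j _; rewrite /= coefE /d ia mulr0.
rewrite raddf_sum (bigD1 c) //= [X in _ + X]big1 ?addr0; last first.
  move=> k /negPf kc; rewrite raddf_sum big1 // => j _.
  by rewrite /= coefE /d kc !andbF mulr0.
rewrite raddf_sum (bigD1 b) //= [X in _ + X]big1 ?addr0; last first.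
  by move=> j /negPf jb; rewrite /= coefE /d jb andbF mulr0.
by rewrite /= coefE /d !eqxx mulr1.
Qed.

(** Deleting an end vertex leaves the edge [(b, c)] or [(a, b)], which cannot be the non-edge
    [(i, k)]; only deletion of the middle vertex, with weight [xi], can contribute. *)
Lemma coeff_bd_path3 i k a b c : i != k -> ~~ edge i k -> edge a b ->
  edge b c ->
  coeff [:: i; k] (bd_path xi [:: a; b; c]) = xi * ((a == i) && (c == k))%:R.
Proof.
move=> ik nik ab bc; rewrite /bd_path /= raddf_sum big_mkcond.
rewrite !big_ord_recl big_ord0 /omit /regular /= !andbT addr0.
rewrite /= !coeffZ !coeff_epath !eqseq_cons !andbT.
have -> : (b == i) && (c == k) = false.
  by apply: contraNF nik => /andP[/eqP<- /eqP<-].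
have -> : (a == i) && (b == k) = false.
  by apply: contraNF nik => /andP[/eqP<- /eqP<-].
rewrite !mulr0 !if_same add0r addr0.
(* If [a = c], the middle deletion is irregular and dropped; the right side vanishes too, because
   [i != k]. *)
case: ifPn => // /negPn/eqP <-.
case: (eqVneq a i) => [->|_]; last by rewrite mulr0.
by rewrite (negPf ik) mulr0.
Qed.

Lemma coeff_bd_nonedge v i k : in_A 2 v -> i != k -> ~~ edge i k ->
  coeff [:: i; k] (bd xi v) = xi * \sum_j coeff [:: i; j; k] v.
Proof.
move=> Av ik nik; rewrite {1}(chain2_sumE Av).
have bdE a b c : coeff [:: i; k]
    (bd xi (coeff [:: a; b; c] v *: epath C [:: a; b; c])) =
    coeff [:: a; b; c] v * (xi * ((a == i) && (c == k))%:R).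
  rewrite bd_scale_epath coeffZ.
  (* Paths with nonzero coefficient are allowed, which supplies the edges that [coeff_bd_path3]
     requires. *)
  have [->|vs] := eqVneq (coeff [:: a; b; c] v) 0; first by rewrite !mul0r.
  have [a' [b' [c' [[-> -> ->] ab bc]]]] := in_A2P Av vs.
  by rewrite coeff_bd_path3.
rewrite 2!raddf_sum (bigD1 i) //= [X in _ + X]big1 ?addr0; last first.
  move=> a /negPf ai; rewrite 2!raddf_sum big1 // => c _.
  by rewrite 2!raddf_sum big1 // => b _; rewrite /= bdE ai !mulr0.
rewrite 2!raddf_sum (bigD1 k) //= [X in _ + X]big1 ?addr0; last first.
  move=> c /negPf ck; rewrite 2!raddf_sum big1 // => b _.
  by rewrite /= bdE ck andbF !mulr0.
rewrite 2!raddf_sum mulr_sumr; apply: eq_bigr => b _.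
by rewrite /= bdE !eqxx mulr1 mulrC.
Qed.

Lemma Omega2_spanned N v : (2 <= N)%N -> xi != 0 -> in_Omega xi N 2 v ->
  spanned (fun u : chain C G =>
    is_double_edge u \/ is_triangle u \/ is_square u) v.
Proof.
move=> N2 xi0 Ov.
have [Av Abd] : in_Omega_q xi 1 2 v by apply: Ov; rewrite /= ltn_predRL.
rewrite {}[v in spanned _ v](chain2_sumE Av).
apply: spanned_sum => i; apply: spanned_sum => k.
have [ik|nik] := boolP ((i == k) || edge i k).
  apply: spanned_sum => j.
  have [->|vs] := eqVneq (coeff [:: i; j; k] v) 0.
    by rewrite scale0r; exact: spanned0.
  have [a [b [c [[<- <- <-] ij jk]]]] := in_A2P Av vs.
  apply: spanned_scale; have [eik|neik] := eqVneq i k.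
    by left; exists i, j; rewrite -eik in jk *.
  by right; left; exists i, j, k; split=> //; rewrite (negPf neik) in ik.
move: nik; rewrite negb_or => /andP[ik nik].
have sum0 : \sum_j coeff [:: i; j; k] v = 0.
  apply/eqP; rewrite -(mulrI_eq0 _ (mulfI xi0)) -coeff_bd_nonedge //.
  (* The support of [bd xi v] consists of edges, so it does not contain [[:: i; k]]. *)
  apply/eqP/coeff_outdom; apply: contraNN nik => /(allP Abd).
  by rewrite /allowed /= andbT => /andP[].
have [j0 vj0|v0] := pickP (fun j => coeff [:: i; j; k] v != 0); last first.
  apply: spanned_sum => j.
  by rewrite (eqP (negbFE (v0 j))) scale0r; exact: spanned0.
(* Subtract zero in the form of the vanishing coefficient sum times the path through [j0], then pair
   the terms over [j]. *)
rewrite -[X in spanned _ X]subr0 -[X in _ - X](scale0r (epath C [:: i; j0; k])).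
rewrite -sum0 scaler_suml -sumrB; apply: spanned_sum => j.
rewrite -scalerBr.
have [->|vj] := eqVneq (coeff [:: i; j; k] v) 0.
  by rewrite scale0r; exact: spanned0.
(* The term [j = j0] cancels; a square needs two distinct middle vertices. *)
have [->|jj0] := eqVneq j j0; first by rewrite subrr scaler0; exact: spanned0.
apply: spanned_scale; right; right; exists i, j, k, j0.
have [? [? [? [[<- <- <-] ij jk]]]] := in_A2P Av vj.
by have [? [? [? [[<- <- <-] ij0 j0k]]]] := in_A2P Av vj0.
Qed.

End Chains.

Theorem theorem3p2 (R : realType) (N : nat) (hN : (2 <= N)%N)
    (xi : R[i]) (hxi : N.-primitive_root xi) (G : digraph)
    (v : chain R[i] G) (hv : in_Omega xi N 2 v) :
  exists (m : nat) (c : 'I_m -> R[i]) (u : 'I_m -> chain R[i] G),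
    (forall r : 'I_m,
       is_double_edge (u r) \/ is_triangle (u r) \/ is_square (u r)) /\
    v = \sum_(r < m) c r *: u r.
Proof.
(* A primitive root of unity of positive order is nonzero. *)
have xi0 : xi != 0 by rewrite (prim_root_eq0 hxi) -lt0n ltnW.
exact: (Omega2_spanned hN xi0 hv).
Qed.
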